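(* The construction $\mathbf G$, sending a regular $*$-semigroup $S$ to $\mathbf G(S)=(P(S),\mathcal G(S),\varepsilon(S))$ and a $*$-semigroup homomorphism to itself (as a map of underlying sets), is a functor $\mathbf{RSS}\to\mathbf{CPG}$ from the category of regular $*$-semigroups to the category of chained projection groupoids.
   Context: **Regular $*$-semigroups.** A regular $*$-semigroup is a semigroup $S$ with a unary operation $a\mapsto a^*$ such that $(a^* )^*=a=aa^*a$ and $(ab)^*=b^*a^*$ for all $a,b\in S$. A $*$-semigroup homomorphism is a map preserving the product and $^*$. $\mathbf{RSS}$ is the resulting category. **Conventions.** Small categories are identified with their sets of morphisms, and objects with identity morphisms; $v\mathcal G$ is the object set, $\mathbf d(a),\mathbf r(a)$ are domain and codomain, and $a\circ b$ is composed left to right (defined iff $\mathbf r(a)=\mathbf d(b)$). Maps are written to the right of their arguments and composed left to right, except evaluation maps $\varepsilon$, written on the left. **Ordered groupoids.** An ordered groupoid is a groupoid $\mathcal G$ with a partial order $\leq$ (on morphisms) such that: (O1) $a\leq b$ implies $\mathbf d(a)\leq\mathbf d(b)$ and $\mathbf r(a)\leq\mathbf r(b)$; (O2) $a\leq b$ implies $a^{-1}\leq b^{-1}$; (O3) if $a\leq b$, $c\leq d$, $\mathbf r(a)=\mathbf d(c)$, $\mathbf r(b)=\mathbf d(d)$, then $a\circ c\leq b\circ d$; (O4) for every object $p\leq\mathbf d(a)$ there is a unique $u\leq a$ with $\mathbf d(u)=p$, denoted ${}_p\downharpoonleft a$. Then for every object $q\leq\mathbf r(a)$ there is a unique $w\leq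 a$ with $\mathbf r(w)=q$, denoted $a\downharpoonright_q$. An ordered groupoid functor is an order-preserving functor. **Projection algebras.** A projection algebra is a set $P$ with maps $\theta_p:P\to P$ ($p\in P$) such that for all $p,q\in P$: $p\theta_p=p$; $\theta_p\theta_p=\theta_p$; $p\theta_q\theta_p=q\theta_p$; $\theta_p\theta_q\theta_p=\theta_{q\theta_p}$; $\theta_p\theta_q\theta_p\theta_q=\theta_p\theta_q$. Define $p\leq q\Leftrightarrow p=p\theta_q$ (a partial order), $p\leq_{\mathscr F}q\Leftrightarrow p=q\theta_p$, and $p\mathrel{\mathscr F}q\Leftrightarrow(p\leq_{\mathscr F}q$ and $q\leq_{\mathscr F}p)$. Write $p^\downarrow=\{q\in P:q\leq p\}$. A projection algebra morphism $\phi:P\to P'$ is a map with $(p\theta_q)\phi=(p\phi)\theta'_{q\phi}$ for all $p,q$. **Chain groupoid.** A $P$-path is a tuple $(p_1,\ldots,p_k)$, $k\geq1$, with $p_1\mathrel{\mathscr F}p_2\mathrel{\mathscr F}\cdots\mathrel{\mathscr F}p_k$; it is a morphism $p_1\to p_k$, and $(p_1,\ldots,p_k)\circ(p_k,\ldots,p_l)=(p_1,\ldots,p_k,\ldots,p_l)$. This gives the path category $\mathscr P(P)$ with object set $P$ ($p\equiv(p)$). For $q\leq p_1$ put ${}_q\downharpoonleft(p_1,\ldots,p_k)=(q_1,\ldots,q_k)$ where $q_1=q$, $q_i=q_{i-1}\theta_{p_i}$. Let $\approx$ be the congruence on $\mathscr P(P)$ generated by all pairs $((p,p),(p))$, and $((p,q,p),(p))$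 with $p\mathrel{\mathscr F}q$. The chain groupoid is $\mathscr C(P)=\mathscr P(P)/{\approx}$, with elements $[p_1,\ldots,p_k]$, inverses $[p_1,\ldots,p_k]^{-1}=[p_k,\ldots,p_1]$, object set $P$ ($p\equiv[p]$). It is an ordered groupoid under: $\mathfrak c\leq\mathfrak d$ iff there are paths $\mathfrak p\in\mathfrak c$, $\mathfrak q\in\mathfrak d$ with $\mathfrak p={}_r\downharpoonleft\mathfrak q$ for some $r\leq\mathbf d(\mathfrak q)$. **Projection groupoids.** A weak projection groupoid is a pair $(P,\mathcal G)$ where $\mathcal G$ is an ordered groupoid, $P=v\mathcal G$ is a projection algebra, and the order of $\mathcal G$ restricted to $P$ is the projection algebra order. For $a\in\mathcal G$ let $\vartheta_a:\mathbf d(a)^\downarrow\to\mathbf r(a)^\downarrow$, $p\vartheta_a=\mathbf r({}_p\downharpoonleft a)$, and $\Theta_a=\theta_{\mathbf d(a)}\vartheta_a:P\to P$. It is a projection groupoid if (G1) every $\vartheta_a$ is a projection algebra morphism, i.e. $(s\theta_t)\vartheta_a=(s\vartheta_a)\theta_{t\vartheta_a}$ for $s,t\leq\mathbf d(a)$. A projection groupoid morphism $(P,\mathcal G)\to(P',\mathcal G')$ is an ordered groupoid functor $\phi:\mathcal G\to\mathcal G'$ whose object map $v\phi:P\to P'$ is a projection algebra morphism. **Weak chained projection groupoids.** These are triples $(P,\mathcal G,\varepsilon)$ with $(P,\mathcal G)$ a projection groupoid and $\varepsilon:\mathscr C(P)\to\mathcal G$ an evaluation map, i.e. an order-preserving functor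 with $\varepsilon(p)=p$ for all $p\in P$. A chained projection functor $(P,\mathcal G,\varepsilon)\to(P',\mathcal G',\varepsilon')$ is a projection groupoid morphism $\phi$ with $(\varepsilon[p_1,\ldots,p_k])\phi=\varepsilon'[p_1\phi,\ldots,p_k\phi]$ for all $[p_1,\ldots,p_k]\in\mathscr C(P)$. **Chained projection groupoids.** For $b\in\mathcal G$ with $\mathbf d(b)=q$, $\mathbf r(b)=r$, a pair $(e,f)\in P\times P$ is $b$-linked if $f=e\Theta_b\theta_f$ and $e=f\Theta_{b^{-1}}\theta_e$. Then put $e_1=e\theta_q$, $e_2=f\Theta_{b^{-1}}$, $f_1=e\Theta_b$, $f_2=f\theta_r$ (one has $e\mathrel{\mathscr F}e_i\leq q$, $f\mathrel{\mathscr F}f_i\leq r$ and ${}_{e_i}\downharpoonleft b=b\downharpoonright_{f_i}$), and $\lambda(e,b,f)=\varepsilon[e,e_1]\circ{}_{e_1}\downharpoonleft b\circ\varepsilon[f_1,f]$, $\rho(e,b,f)=\varepsilon[e,e_2]\circ{}_{e_2}\downharpoonleft b\circ\varepsilon[f_2,f]$. A chained projection groupoid is a weak chained projection groupoid with (G2): $\lambda(e,b,f)=\rho(e,b,f)$ for every $b\in\mathcal G$ and every $b$-linked pair $(e,f)$. $\mathbf{CPG}$ is the category of chained projection groupoids with all chained projection functors between them. **The triple $\mathbf G(S)$.** For a regular $*$-semigroup $S$: $P(S)=\{p\in S:p^2=p=p^*\}$ with operations $q\theta_p=pqp$. $\mathcal G(S)$ is the ordered groupoid with morphism set $S$, object set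 $P(S)$, $\mathbf d(a)=aa^*$, $\mathbf r(a)=a^*a$, $a\circ b=ab$ when $\mathbf r(a)=\mathbf d(b)$, $a^{-1}=a^*$, ${}_p\downharpoonleft a=pa$ for $p\leq\mathbf d(a)$, and $a\leq b$ iff $a={}_p\downharpoonleft b$ for some $p\leq\mathbf d(b)$. $\varepsilon(S):\mathscr C(P(S))\to\mathcal G(S)$ is given by $\varepsilon[p_1,\ldots,p_k]=p_1\cdots p_k$ (product in $S$). *)

(* Defs.v *)
From HB Require Import structures.
From mathcomp Require Import all_boot.
From mathcomp Require Import boolp.

Set Implicit Arguments.
Unset Strict Implicit.
Unset Printing Implicit Defensive.

Local Open Scope group_scope.
Local Open Scope quotient_scope.

(** * Categories and functors *)

Record category := Category {
  ob : Type;
  hom : ob -> ob -> Type;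
  idh : forall x, hom x x;
  comph : forall x y z, hom x y -> hom y z -> hom x z;
  comp_idh : forall x y (f : hom x y), comph (idh x) f = f;
  comph_id : forall x y (f : hom x y), comph f (idh y) = f;
  comphA : forall x y z t (f : hom x y) (g : hom y z) (h : hom z t),
    comph f (comph g h) = comph (comph f g) h }.

Record is_functor (C D : category) (Fob : ob C -> ob D)
    (Fhom : forall x y, hom x y -> hom (Fob x) (Fob y)) : Prop := IsFunctor {
  functor_id : forall x : ob C, Fhom x x (idh x) = idh (Fob x);
  functor_comp : forall (x y z : ob C) (f : hom x y) (g : hom y z),
    Fhom x z (comph f g) = comph (Fhom x y f) (Fhom y z g) }.

(** * Regular *-semigroups *)

(* A [semigroupType] carries a choice operator; by [gen_choiceMixin] every type
   has one, so this does not restrict the semigroups. Homomorphisms ignore it. *)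
HB.mixin Record isRegularStar S of Semigroup S := {
  star : S -> S;
  starK : involutive star;
  mul_star : forall a : S, a * star a * a = a;
  starM : forall a b : S, star (a * b) = star b * star a }.

#[short(type="rssType")]
HB.structure Definition RegularStarSemigroup :=
  { S of isRegularStar S & Semigroup S }.

Record is_star_hom (S T : rssType) (phi : S -> T) : Prop := IsStarHom {
  star_homM : forall a b, phi (a * b) = phi a * phi b;
  star_homS : forall a, phi (star a) = star (phi a) }.

Record star_hom (S T : rssType) := StarHom {
  star_fun :> S -> T;
  star_homP : is_star_hom star_fun }.

Lemma star_hom_eq (S T : rssType) (f g : star_hom S T) :
  (forall x, f x = g x) -> f = g.
Proof.
case: f g => f Hf [g Hg] /= /funext efg; rewrite -{}efg in Hg *.
by rewrite (Prop_irrelevance Hf Hg).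
Qed.

Lemma star_hom_id_subproof (S : rssType) : is_star_hom (fun x : S => x).
Proof. by []. Qed.

Definition star_hom_id (S : rssType) : star_hom S S :=
  StarHom (star_hom_id_subproof S).

Lemma star_hom_comp_subproof (S T U : rssType) (f : star_hom S T)
  (g : star_hom T U) : is_star_hom (fun x => g (f x)).
Proof.
split=> [a b|a].
  by rewrite (star_homM (star_homP f)) (star_homM (star_homP g)).
by rewrite (star_homS (star_homP f)) (star_homS (star_homP g)).
Qed.

Definition star_hom_comp (S T U : rssType) (f : star_hom S T)
  (g : star_hom T U) : star_hom S U := StarHom (star_hom_comp_subproof f g).

Definition RSS : category.
Proof.
exists rssType star_hom star_hom_id star_hom_comp.
- by move=> S T f; apply: star_hom_eq.
- by move=> S T f; apply: star_hom_eq.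
- by move=> S T U V f g h; apply: star_hom_eq.
Defined.

(** * Projection algebras *)

(* [theta p q] is the image q theta_p of q under the map theta_p. *)
Record projalg_data := ProjAlg {
  pa_sort :> Type;
  theta : pa_sort -> pa_sort -> pa_sort }.

Record is_projalg (P : projalg_data) : Prop := IsProjAlg {
  theta_fix : forall p : P, theta p p = p;
  theta_idem : forall p x : P, theta p (theta p x) = theta p x;
  theta_absorb : forall p q : P, theta p (theta q p) = theta p q;
  theta_conj : forall p q x : P,
    theta p (theta q (theta p x)) = theta (theta p q) x;
  theta_alt : forall p q x : P,
    theta q (theta p (theta q (theta p x))) = theta q (theta p x) }.

Definition pale (P : projalg_data) (p q : P) : Prop := p = theta q p.

Definition paleF (P : projalg_data) (p q : P) : Prop := p = theta p q.

Definition friend (P : projalg_data) (p q : P) : Prop :=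
  paleF p q /\ paleF q p.

Definition is_projalg_morphism (P P' : projalg_data) (v : P -> P') : Prop :=
  forall p q : P, v (theta q p) = theta (v q) (v p).

(** * Ordered groupoids *)

(* [P] is the set of objects and [mor G] the set of morphisms; an object [p] is
   identified with the morphism [gid p]. Composition is from left to right. *)
Record ogpd_data (P : Type) := OGpd {
  mor : Type;
  gdom : mor -> P;
  gcod : mor -> P;
  gid : P -> mor;
  gcomp : forall a b : mor, gcod a = gdom b -> mor;
  ginv : mor -> mor;
  gle : mor -> mor -> Prop }.

Definition obj_le (P : Type) (G : ogpd_data P) (p q : P) : Prop :=
  gle (gid G p) (gid G q).

Record is_ordered_groupoid (P : Type) (G : ogpd_data P) : Prop := IsOGpd {
  gdom_id : forall p, gdom (gid G p) = p;
  gcod_id : forall p, gcod (gid G p) = p;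
  gdom_comp : forall (a b : mor G) (h : gcod a = gdom b),
    gdom (gcomp h) = gdom a;
  gcod_comp : forall (a b : mor G) (h : gcod a = gdom b),
    gcod (gcomp h) = gcod b;
  gcomp_idl : forall (a : mor G) (h : gcod (gid G (gdom a)) = gdom a),
    gcomp h = a;
  gcomp_idr : forall (a : mor G) (h : gcod a = gdom (gid G (gcod a))),
    gcomp h = a;
  gcompA : forall (a b c : mor G) (hab : gcod a = gdom b)
      (hbc : gcod b = gdom c) (hl : gcod (gcomp hab) = gdom c)
      (hr : gcod a = gdom (gcomp hbc)),
    gcomp hl = gcomp hr;
  gdom_inv : forall a : mor G, gdom (ginv a) = gcod a;
  gcod_inv : forall a : mor G, gcod (ginv a) = gdom a;
  gcomp_invr : forall (a : mor G) (h : gcod a = gdom (ginv a)),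
    gcomp h = gid G (gdom a);
  gcomp_invl : forall (a : mor G) (h : gcod (ginv a) = gdom a),
    gcomp h = gid G (gcod a);
  gle_refl : forall a : mor G, gle a a;
  gle_antisym : forall a b : mor G, gle a b -> gle b a -> a = b;
  gle_trans : forall a b c : mor G, gle a b -> gle b c -> gle a c;
  gle_dom_cod : forall a b : mor G, gle a b ->
    obj_le G (gdom a) (gdom b) /\ obj_le G (gcod a) (gcod b);
  gle_inv : forall a b : mor G, gle a b -> gle (ginv a) (ginv b);
  gle_comp : forall (a b c d : mor G) (hac : gcod a = gdom c)
      (hbd : gcod b = gdom d),
    gle a b -> gle c d -> gle (gcomp hac) (gcomp hbd);
  gle_restr : forall (a : mor G) (p : P), obj_le G p (gdom a) ->
    exists! u, gle u a /\ gdom u = p }.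

(* The left restriction of [a] to [p], for [p] below [gdom a]; the value [a]
   for other [p] is irrelevant. *)
Definition restr (P : Type) (G : ogpd_data P) (p : P) (a : mor G) : mor G :=
  if pselect (exists u, gle u a /\ gdom u = p) is left h
  then sval (cid h) else a.

(* The composite of [a] and [b] when it is defined; the value [a] otherwise is
   irrelevant. It is used below only where the composite is defined. *)
Definition gcompd (P : Type) (G : ogpd_data P) (a b : mor G) : mor G :=
  if pselect (gcod a = gdom b) is left h then gcomp h else a.

Definition vmap (P P' : Type) (G : ogpd_data P) (G' : ogpd_data P')
  (phi : mor G -> mor G') (p : P) : P' := gdom (phi (gid G p)).

Record is_ordered_functor (P P' : Type) (G : ogpd_data P) (G' : ogpd_data P')
    (phi : mor G -> mor G') : Prop := IsOFunctor {
  ofun_id : forall p, phi (gid G p) = gid G' (vmap phi p);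
  ofun_dom : forall a, gdom (phi a) = vmap phi (gdom a);
  ofun_cod : forall a, gcod (phi a) = vmap phi (gcod a);
  ofun_comp : forall (a b : mor G) (h : gcod a = gdom b)
      (h' : gcod (phi a) = gdom (phi b)),
    phi (gcomp h) = gcomp h';
  ofun_le : forall a b : mor G, gle a b -> gle (phi a) (phi b) }.

(** * The chain groupoid *)

Definition friendb (P : projalg_data) (p q : P) : bool := `[< friend p q >].

(* The path (p_1, ..., p_k) has head p_1 and tail [:: p_2; ...; p_k]. *)
Record ppath (P : projalg_data) := PPath {
  phead : P;
  ptail : seq P;
  ppathP : path (@friendb P) phead ptail }.

HB.instance Definition _ (P : projalg_data) := gen_eqMixin (ppath P).
HB.instance Definition _ (P : projalg_data) := gen_choiceMixin (ppath P).

Section Paths.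
Variable P : projalg_data.
Implicit Types (p q : P) (s t : ppath P).

Definition plast s : P := last (phead s) (ptail s).

Definition ptriv p : ppath P := @PPath P p [::] isT.

Lemma friendb_sym p q : friendb p q = friendb q p.
Proof. by apply/asboolP/asboolP => -[]. Qed.

Lemma ppair_subproof p q : friend p q -> path (@friendb P) p [:: q].
Proof. by move=> /asboolT pq; rewrite /= andbT. Qed.

Definition ppair p q (h : friend p q) : ppath P := PPath (ppair_subproof h).

Lemma pback_subproof p q : friend p q -> path (@friendb P) p [:: q; p].
Proof. by move=> /asboolT pq; rewrite /= (friendb_sym q p) /friendb pq. Qed.

Definition pback p q (h : friend p q) : ppath P := PPath (pback_subproof h).

Lemma pcomp_subproof s t : plast s = phead t ->
  path (@friendb P) (phead s) (ptail s ++ ptail t).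
Proof.
by rewrite cat_path ppathP -/(plast s) => ->; rewrite ppathP.
Qed.

Definition pcomp s t (h : plast s = phead t) : ppath P :=
  PPath (pcomp_subproof h).

Lemma pinv_subproof s :
  path (@friendb P) (plast s) (rev (belast (phead s) (ptail s))).
Proof.
rewrite rev_path (@eq_path _ _ (@friendb P)) ?ppathP // => p q.
exact: friendb_sym.
Qed.

Definition pinv s : ppath P := PPath (pinv_subproof s).

(* [s] is the restriction of [t] to [r]: s_1 = r and s_i = s_{i-1} theta_{t_i}. *)
Definition is_prestr (r : P) t s : Prop :=
  phead s = r /\ ptail s = scanl (fun x y => theta y x) r (ptail t).

(* The relation for (p,p) and (p) carries the proof of [friend p p], which holds
   in every projection algebra. *)
Inductive chain_eq : ppath P -> ppath P -> Prop :=
| chain_eq_dup p (h : friend p p) : chain_eq (ppair h) (ptriv p)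
| chain_eq_back p q (h : friend p q) : chain_eq (pback h) (ptriv p)
| chain_eq_comp s s' t t' (h : plast s = phead t) (h' : plast s' = phead t') :
    chain_eq s s' -> chain_eq t t' -> chain_eq (pcomp h) (pcomp h')
| chain_eq_refl s : chain_eq s s
| chain_eq_sym s t : chain_eq s t -> chain_eq t s
| chain_eq_trans s t u : chain_eq s t -> chain_eq t u -> chain_eq s u.

Definition chain_eqb : rel (ppath P) := fun s t => `[< chain_eq s t >].

Lemma chain_eqb_equiv : equiv_class_of chain_eqb.
Proof.
split=> [s|s t|t s u].
- by apply: asboolT; apply: chain_eq_refl.
- by apply/asboolP/asboolP; apply: chain_eq_sym.
- by move=> /asboolP st /asboolP tu; apply: asboolT; apply: chain_eq_trans tu.
Qed.

Canonical chain_equiv := EquivRelPack chain_eqb_equiv.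

Definition chain := {eq_quot chain_equiv}.

(* The chain [p, s_1, ..., s_n] of a sequence that is a path; the value for other
   sequences is irrelevant. *)
Definition mkchain (p : P) (s : seq P) : chain :=
  if pselect (path (@friendb P) p s) is left h
  then \pi_chain (PPath h) else \pi_chain (ptriv p).

(* The maps below are defined on chosen representatives; they do not depend on
   the choice, by [chain_domE] and the following lemmas. *)
Definition chain_dom (c : chain) : P := phead (repr c).

Definition chain_cod (c : chain) : P := plast (repr c).

Definition chain_comp (c d : chain) (h : chain_cod c = chain_dom d) : chain :=
  \pi_chain (pcomp h).

Definition chain_inv (c : chain) : chain := \pi_chain (pinv (repr c)).

Definition chain_le (c d : chain) : Prop :=
  exists s t : ppath P, [/\ c = \pi_chain s, d = \pi_chain t &
    exists2 r, pale r (phead t) & is_prestr r t s].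

Definition chain_gpd : ogpd_data P :=
  @OGpd P chain chain_dom chain_cod (fun p => \pi_chain (ptriv p)) chain_comp chain_inv
    chain_le.

Lemma ppath_eq s t : phead s = phead t -> ptail s = ptail t -> s = t.
Proof.
case: s t => p s hs [q t ht] /= epq est; subst q t.
by rewrite (bool_irrelevance hs ht).
Qed.

Lemma chain_eq_ends s t : chain_eq s t ->
  phead s = phead t /\ plast s = plast t.
Proof.
elim=> // {s t} [s s' t t' h h' _ [e1 e2] _ [e3 e4]|s t _ [-> ->] //|].
  by rewrite /plast /= !last_cat -/(plast s) -/(plast s') h h'.
by move=> s t u _ [-> ->] _ [-> ->].
Qed.

Lemma chain_piP s t : \pi_chain s = \pi_chain t <-> chain_eq s t.
Proof.
have R := eqmodP chain_equiv s t.
by split=> [/R /asboolP //|st]; apply/R; apply: asboolT.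
Qed.

Lemma chain_piE s t : chain_eq s t -> \pi_chain s = \pi_chain t.
Proof. by move=> st; apply/chain_piP. Qed.

Lemma chain_reprK s : chain_eq (repr (\pi_chain s)) s.
Proof. by apply/chain_piP; rewrite reprK. Qed.

Lemma chain_domE s : chain_dom (\pi_chain s) = phead s.
Proof. by case: (chain_eq_ends (chain_reprK s)). Qed.

Lemma chain_codE s : chain_cod (\pi_chain s) = plast s.
Proof. by case: (chain_eq_ends (chain_reprK s)). Qed.

Lemma chain_compE s t (h : plast s = phead t)
    (h' : chain_cod (\pi_chain s) = chain_dom (\pi_chain t)) :
  chain_comp h' = \pi_chain (pcomp h).
Proof. by apply: chain_piE; apply: chain_eq_comp; apply: chain_reprK. Qed.

Lemma pinv_eq s t : chain_eq s t -> chain_eq (pinv s) (pinv t).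
Proof.
elim=> {s t}.
- move=> p h; rewrite (_ : pinv (ppair h) = ppair h); last exact: ppath_eq.
  rewrite (_ : pinv (ptriv p) = ptriv p); last exact: ppath_eq.
  exact: chain_eq_dup.
- move=> p q h; rewrite (_ : pinv (pback h) = pback h); last exact: ppath_eq.
  rewrite (_ : pinv (ptriv p) = ptriv p); last exact: ppath_eq.
  exact: chain_eq_back.
- have lastinv s : plast (pinv s) = phead s.
    case: s => p [|q s] hs; rewrite /plast //=.
    by rewrite rev_cons last_rcons.
  have invE s t (h : plast s = phead t) (h' : plast (pinv t) = phead (pinv s)) :
      pinv (pcomp h) = pcomp h'.
    apply: ppath_eq; first by rewrite /= /plast last_cat -/(plast s) h.
    by rewrite /= belast_cat rev_cat -/(plast s) h.
  move=> s s' t t' h h' _ ss _ tt.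
  have k : plast (pinv t) = phead (pinv s) by rewrite lastinv -h.
  have k' : plast (pinv t') = phead (pinv s') by rewrite lastinv -h'.
  by rewrite (invE _ _ h k) (invE _ _ h' k'); apply: chain_eq_comp.
- by move=> s; apply: chain_eq_refl.
- by move=> s t _; apply: chain_eq_sym.
- by move=> s t u _ st _; apply: chain_eq_trans.
Qed.

Lemma chain_invE s : chain_inv (\pi_chain s) = \pi_chain (pinv s).
Proof. by apply: chain_piE; apply: pinv_eq; apply: chain_reprK. Qed.

End Paths.

(** * Projection groupoids *)

Record pgpd_data := PGpd {
  pg_alg : projalg_data;
  pg_gpd : ogpd_data pg_alg }.

Record is_weak_pgpd (X : pgpd_data) : Prop := IsWeakPGpd {
  wpg_alg : is_projalg (pg_alg X);
  wpg_gpd : is_ordered_groupoid (pg_gpd X);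
  wpg_le : forall p q : pg_alg X, obj_le (pg_gpd X) p q <-> pale p q }.

Definition vartheta (X : pgpd_data) (a : mor (pg_gpd X)) (p : pg_alg X) :
  pg_alg X := gcod (restr p a).

Definition Theta (X : pgpd_data) (a : mor (pg_gpd X)) (p : pg_alg X) :
  pg_alg X := vartheta a (theta (gdom a) p).

Record is_pgpd (X : pgpd_data) : Prop := IsPGpd {
  pg_weak : is_weak_pgpd X;
  pg_G1 : forall (a : mor (pg_gpd X)) (s t : pg_alg X),
    pale s (gdom a) -> pale t (gdom a) ->
    vartheta a (theta t s) = theta (vartheta a t) (vartheta a s) }.

Record is_pgpd_morphism (X Y : pgpd_data)
    (phi : mor (pg_gpd X) -> mor (pg_gpd Y)) : Prop := IsPGpdMorphism {
  pgm_fun : is_ordered_functor phi;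
  pgm_alg : is_projalg_morphism (vmap phi) }.

(** * Chained projection groupoids *)

Record cpg_data := CPGData {
  cpg_pg :> pgpd_data;
  ev : chain (pg_alg cpg_pg) -> mor (pg_gpd cpg_pg) }.

Record is_weak_cpg (X : cpg_data) : Prop := IsWeakCPG {
  wcpg_pg : is_pgpd X;
  wcpg_ev : is_ordered_functor (G := chain_gpd (pg_alg X)) (@ev X);
  wcpg_ev_id : forall p : pg_alg X, ev (gid (chain_gpd _) p) = gid (pg_gpd X) p }.

Definition linked (X : pgpd_data) (b : mor (pg_gpd X)) (e f : pg_alg X) : Prop :=
  f = theta f (Theta b e) /\ e = theta e (Theta (ginv b) f).

(* For a [b]-linked pair (e, f), the sequences (e, e_i) and (f_i, f) are paths and
   all the composites are defined. *)
Definition lambda (X : cpg_data) (e : pg_alg X) (b : mor (pg_gpd X))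
    (f : pg_alg X) : mor (pg_gpd X) :=
  let e1 := theta (gdom b) e in
  let f1 := Theta b e in
  gcompd (gcompd (ev (mkchain e [:: e1])) (restr e1 b)) (ev (mkchain f1 [:: f])).

Definition rho (X : cpg_data) (e : pg_alg X) (b : mor (pg_gpd X))
    (f : pg_alg X) : mor (pg_gpd X) :=
  let e2 := Theta (ginv b) f in
  let f2 := theta (gcod b) f in
  gcompd (gcompd (ev (mkchain e [:: e2])) (restr e2 b)) (ev (mkchain f2 [:: f])).

Record is_cpg (X : cpg_data) : Prop := IsCPG {
  cpg_weak : is_weak_cpg X;
  cpg_G2 : forall (b : mor (pg_gpd X)) (e f : pg_alg X),
    linked b e f -> lambda e b f = rho e b f }.

(* The morphism [vmap phi] preserves the relation [friend], so it maps paths to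
   paths. *)
Record is_chained_functor (X Y : cpg_data)
    (phi : mor (pg_gpd X) -> mor (pg_gpd Y)) : Prop := IsChainedFunctor {
  chf_pg : is_pgpd_morphism phi;
  chf_ev : forall (p : pg_alg X) (s : seq (pg_alg X)),
    path (@friendb _) p s ->
    phi (ev (mkchain p s)) = ev (mkchain (vmap phi p) (map (vmap phi) s)) }.

Record cpg := CPGOb {
  cpg_car :> cpg_data;
  cpgP : is_cpg cpg_car }.

Record chained_functor (X Y : cpg_data) := ChainedFunctor {
  chained_fun :> mor (pg_gpd X) -> mor (pg_gpd Y);
  chained_funP : is_chained_functor chained_fun }.

Lemma chained_functor_eq (X Y : cpg_data) (f g : chained_functor X Y) :
  (forall x, f x = g x) -> f = g.
Proof.
case: f g => f Hf [g Hg] /= /funext efg; rewrite -{}efg in Hg *.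
by rewrite (Prop_irrelevance Hf Hg).
Qed.

Lemma friend_morphism (P P' : projalg_data) (v : P -> P') (p : P) (s : seq P) :
  is_projalg_morphism v -> path (@friendb P) p s ->
  path (@friendb P') (v p) (map v s).
Proof.
move=> Hv; rewrite path_map.
apply: (@sub_path _ (@friendb P) (relpre v (@friendb P'))) => x y.
move=> /asboolP[xy yx]; apply: asboolT; split; rewrite /paleF -Hv.
  by rewrite -[theta x y]xy.
by rewrite -[theta y x]yx.
Qed.

Lemma chained_functor_id_subproof (X : cpg) :
  is_chained_functor (X := X) (Y := X) (fun a => a).
Proof.
have HG := wpg_gpd (pg_weak (wcpg_pg (cpg_weak (cpgP X)))).
have vE : vmap (G := pg_gpd X) (G' := pg_gpd X) (fun a => a) = id.
  by apply: funext => p; apply: gdom_id.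
split; first split.
- by split; rewrite ?vE //= => a b h h'; rewrite (Prop_irrelevance h h').
- by rewrite vE.
- by move=> p s _; rewrite vE map_id.
Qed.

Definition chained_functor_id (X : cpg) : chained_functor X X :=
  ChainedFunctor (chained_functor_id_subproof X).

Lemma chained_functor_comp_subproof (X Y Z : cpg) (f : chained_functor X Y)
    (g : chained_functor Y Z) :
  is_chained_functor (X := X) (Y := Z) (fun a => g (f a)).
Proof.
case: f g => f [[Hf Hvf] Hf'] [g [[Hg Hvg] Hg']] /=.
have vE : vmap (G := pg_gpd X) (G' := pg_gpd Z) (fun a => g (f a)) =
    fun p => vmap g (vmap f p).
  by apply: funext => p; rewrite {1}/vmap (ofun_id Hf).
split; first split.
- split; rewrite ?vE.
  + by move=> p; rewrite (ofun_id Hf) (ofun_id Hg).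
  + by move=> a; rewrite (ofun_dom Hg) (ofun_dom Hf).
  + by move=> a; rewrite (ofun_cod Hg) (ofun_cod Hf).
  + move=> a b h h'.
    have k : gcod (f a) = gdom (f b).
      by rewrite (ofun_dom Hf) (ofun_cod Hf) h.
    by rewrite (ofun_comp Hf h k) (ofun_comp Hg k h').
  + by move=> a b ab; apply: (ofun_le Hg); apply: (ofun_le Hf).
- by move=> p q; rewrite vE Hvf Hvg.
- move=> p s ps; rewrite vE Hf' // Hg' -?map_comp //.
  exact: friend_morphism.
Qed.

Definition chained_functor_comp (X Y Z : cpg) (f : chained_functor X Y)
    (g : chained_functor Y Z) : chained_functor X Z :=
  ChainedFunctor (chained_functor_comp_subproof f g).

Definition CPG : category.
Proof.
exists cpg chained_functor chained_functor_id chained_functor_comp.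
- by move=> X Y f; apply: chained_functor_eq.
- by move=> X Y f; apply: chained_functor_eq.
- by move=> X Y Z T f g h; apply: chained_functor_eq.
Defined.

(** * The triple G(S) *)

Section GS.
Variable S : rssType.
Implicit Types a b : S.

Definition is_proj (p : S) : Prop := p * p = p /\ star p = p.

Definition projS : Type := {p : S | is_proj p}.

Implicit Types p q : projS.

Lemma proj_mulK (p q : S) : is_proj p -> is_proj q -> p * q * p * q = p * q.
Proof.
move=> [pp ps] [qq qs]; rewrite -[RHS]mul_star starM ps qs !mulgA.
by rewrite -(mulgA p q q) qq -(mulgA (p * q) p p) pp.
Qed.

Lemma thetaS_subproof p q : is_proj (sval p * sval q * sval p).
Proof.
case: p q => p Hp [q Hq] /=; split; last first.
  by rewrite !starM (proj2 Hp) (proj2 Hq) mulgA.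
rewrite !mulgA -(mulgA (p * q) p p) (proj1 Hp).
by rewrite proj_mulK.
Qed.

Definition thetaS p q : projS := exist _ _ (thetaS_subproof p q).

Definition PS : projalg_data := ProjAlg thetaS.

Lemma domS_subproof a : is_proj (a * star a).
Proof. by split; rewrite ?starM ?starK // mulgA mul_star. Qed.

Lemma codS_subproof a : is_proj (star a * a).
Proof. by have := domS_subproof (star a); rewrite starK. Qed.

Definition domS a : PS := exist _ _ (domS_subproof a).

Definition codS a : PS := exist _ _ (codS_subproof a).

Definition leS a b : Prop := exists2 p : PS, pale p (domS b) & a = sval p * b.

Definition GS_gpd : ogpd_data PS :=
  @OGpd PS S domS codS sval (fun a b (_ : codS a = domS b) => a * b) (@star S)
    leS.

Definition GS_pgpd : pgpd_data := PGpd GS_gpd.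

Definition mulprojS (a : S) (p : PS) : S := a * sval p.

Definition pprodS (s : ppath PS) : S :=
  foldl mulprojS (sval (phead s)) (ptail s).

Definition evS (c : chain PS) : S := pprodS (repr c).

Definition GS : cpg_data := @CPGData GS_pgpd evS.

Lemma foldl_mulprojS (a b : S) (u : seq PS) :
  foldl mulprojS (a * b) u = a * foldl mulprojS b u.
Proof. by elim: u b => [//|p u IHu] b /=; rewrite -IHu /mulprojS mulgA. Qed.

Lemma pprodS_last (s : ppath PS) : mulprojS (pprodS s) (plast s) = pprodS s.
Proof.
case: s => p s hs; rewrite /pprodS /plast /mulprojS /=.
elim/last_ind: s {hs} => [|s q _] /=; first by case: (svalP p).
by rewrite last_rcons foldl_rcons /mulprojS -mulgA (proj1 (svalP q)).
Qed.

Lemma pprodS_comp (s t : ppath PS) (h : plast s = phead t) :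
  pprodS (pcomp h) = pprodS s * pprodS t.
Proof.
transitivity (foldl mulprojS (pprodS s) (ptail t)).
  by rewrite -foldl_cat.
rewrite [pprodS t]/pprodS -h -foldl_mulprojS.
by rewrite -/(mulprojS _ _) pprodS_last.
Qed.

Lemma pprodS_eq (s t : ppath PS) : chain_eq s t -> pprodS s = pprodS t.
Proof.
elim=> {s t}.
- by move=> p h; rewrite /pprodS /= /mulprojS (proj1 (svalP p)).
- move=> p q h; rewrite /pprodS /= /mulprojS.
  by have /(congr1 sval) := proj1 h.
- by move=> s s' t t' h h' _ ss _ tt; rewrite !pprodS_comp ss tt.
- by [].
- by move=> s t _ ->.
- by move=> s t u _ -> _ ->.
Qed.

Lemma evSE (s : ppath PS) : evS (\pi_(chain PS) s) = pprodS s.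
Proof. by apply: pprodS_eq; apply: chain_reprK. Qed.

End GS.

(* Main.v *)
Require Import Defs.
From mathcomp Require Import all_boot.
From mathcomp Require Import boolp.

Set Implicit Arguments.
Unset Strict Implicit.
Unset Printing Implicit Defensive.

Local Open Scope group_scope.
Local Open Scope quotient_scope.

(** Every structure map of [GS S] is a formula in the product and [star], so homomorphisms preserve
    all of it, and the functor laws are equalities of underlying maps. The content is that [GS S] is
    a chained projection groupoid.

    Restriction is left multiplication by a projection, so [vartheta] and [Theta] are conjugation
    [star a * p * a] ([varthetaE], [ThetaE]); the ordered groupoid axioms and (G1) come down to
    [p * a * star a = p] for [p] below [domS a]. Friends satisfy [p * q * p = p] and
    [q * p * q = q]. Hence the product along a path has the ends of the path as domain and codomain
    ([foldl_mulprojS_ends]), and restricting the path multiplies its product on the left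
    ([foldl_mulprojS_restr]), so [evS] is an order-preserving functor.

    For (G2), linkedness says [e = e * b * f * star b * e] and [f = f * star b * e * b * f]. This
    forces [e * b * star b * e = e] and [f * star b * b * f = f] ([sandwich]), and then [lambda] and
    [rho] collapse to the same product ([GS_G2]). *)

Section RegularStar.
Variable S : rssType.
Implicit Types (a b x : S) (p q r e f : PS S).

(** * Identities for [star] and for projections *)

Lemma star_mul_star a : star a * a * star a = star a.
Proof. by have := mul_star (star a); rewrite starK. Qed.

(** In a product flattened to the left, an inner factor is not a subterm; the [_r] variants carry a
    prefix [x] so that an identity can still be rewritten there. *)
Lemma mul_star_r x a : x * a * star a * a = x * a.
Proof. by rewrite -!mulgA (mulgA a) mul_star. Qed.

Lemma star_mul_star_r x a : x * star a * a * star a = x * star a.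
Proof. by have := mul_star_r x (star a); rewrite starK. Qed.

Lemma PS_eq p q : sval p = sval q -> p = q.
Proof.
case: p q => p hp [q hq] /= e; subst q; congr exist; exact: Prop_irrelevance.
Qed.

Lemma star_sval p : star (sval p) = sval p.
Proof. exact: (proj2 (svalP p)). Qed.

Lemma sval_idem p : sval p * sval p = sval p.
Proof. exact: (proj1 (svalP p)). Qed.

Lemma sval_idem_r x p : x * sval p * sval p = x * sval p.
Proof. by rewrite -mulgA sval_idem. Qed.

Lemma sval_alt p q : sval p * sval q * sval p * sval q = sval p * sval q.
Proof. exact: proj_mulK (svalP p) (svalP q). Qed.

Lemma sval_alt_r x p q :
  x * sval p * sval q * sval p * sval q = x * sval p * sval q.
Proof. by rewrite -!mulgA (mulgA (sval p)) (mulgA (_ * _)) sval_alt. Qed.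

Lemma sval_theta p q : sval (theta p q) = sval p * sval q * sval p.
Proof. by []. Qed.

Lemma domS_sval p : domS (sval p) = p.
Proof. by apply: PS_eq; rewrite /= star_sval sval_idem. Qed.

Lemma codS_sval p : codS (sval p) = p.
Proof. by apply: PS_eq; rewrite /= star_sval sval_idem. Qed.

(** The axioms reduce to [p * p = p] and [p * q * p * q = p * q]; [theta_conj] is pure
    associativity. *)
Lemma PS_projalg : is_projalg (PS S).
Proof.
split=> [p|p x|p q|p q x|p q x]; apply: PS_eq => /=; rewrite ?mulgA.
- by rewrite !sval_idem.
- by rewrite sval_idem sval_idem_r.
- by rewrite sval_alt.
- by [].
- by rewrite sval_alt sval_alt_r.
Qed.

(** * The order on projections, and restrictions *)

Lemma pale_mull p q : pale p q -> sval q * sval p = sval p.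
Proof. by move=> /(congr1 sval) /= ->; rewrite !mulgA sval_idem. Qed.

Lemma pale_mulr p q : pale p q -> sval p * sval q = sval p.
Proof. by move=> /(congr1 sval) /= ->; rewrite sval_idem_r. Qed.

Lemma mul_pale p q :
  sval q * sval p = sval p -> sval p * sval q = sval p -> pale p q.
Proof. by move=> qp pq; apply: PS_eq; rewrite /= qp pq. Qed.

Lemma pale_refl p : pale p p.
Proof. by rewrite /pale (theta_fix PS_projalg). Qed.

Lemma pale_trans p q r : pale p q -> pale q r -> pale p r.
Proof.
move=> pq qr; apply: mul_pale.
  by rewrite -(pale_mull pq) mulgA (pale_mull qr).
by rewrite -(pale_mulr pq) -mulgA (pale_mulr qr).
Qed.

Lemma pale_theta p q : pale (theta q p) q.
Proof. by rewrite /pale (theta_idem PS_projalg). Qed.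

Lemma pale_antisym p q : pale p q -> pale q p -> p = q.
Proof.
by move=> pq qp; apply: PS_eq; rewrite -(pale_mulr pq) (pale_mull qp).
Qed.

Lemma pale_dom_mul p a : pale p (domS a) -> sval p * a * star a = sval p.
Proof. by move=> /pale_mulr /=; rewrite mulgA. Qed.

Lemma pale_dom_mul_r x p a :
  pale p (domS a) -> x * sval p * a * star a = x * sval p.
Proof. by move=> pa; rewrite -2!(mulgA x) pale_dom_mul. Qed.

Lemma domS_restr p a : pale p (domS a) -> domS (sval p * a) = p.
Proof.
move=> pa; apply: PS_eq.
by rewrite /= starM star_sval mulgA pale_dom_mul // sval_idem.
Qed.

Lemma sval_codS_restr p a : sval (codS (sval p * a)) = star a * sval p * a.
Proof. by rewrite /= starM star_sval !mulgA sval_idem_r. Qed.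

Lemma codS_pale p a : pale (codS (sval p * a)) (codS a).
Proof.
by apply: mul_pale; rewrite sval_codS_restr /= !mulgA ?star_mul_star ?mul_star_r.
Qed.

(** * The ordered groupoid *)

Lemma obj_leE p q : obj_le (GS_gpd S) p q <-> pale p q.
Proof.
rewrite /obj_le; split=> [[r]|pq].
  by rewrite domS_sval => rq /= e; rewrite (PS_eq (etrans e (pale_mulr rq))).
by exists p; rewrite ?domS_sval //= pale_mulr.
Qed.

Lemma GS_ordered_groupoid : is_ordered_groupoid (GS_gpd S).
Proof.
split.
- exact: domS_sval.
- exact: codS_sval.
- move=> a b /(congr1 sval) /= h; apply: PS_eq; rewrite /= starM.
  by rewrite mulgA -(mulgA a) -h mulgA mul_star.
- move=> a b /(congr1 sval) /= h; apply: PS_eq; rewrite /= starM.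
  by rewrite mulgA -(mulgA (star b)) h mulgA star_mul_star.
- by move=> a h /=; rewrite mul_star.
- by move=> a h /=; rewrite mulgA mul_star.
- by move=> a b c hab hbc hl hr /=; rewrite mulgA.
- by move=> a; apply: PS_eq; rewrite /= starK.
- by move=> a; apply: PS_eq; rewrite /= starK.
- by [].
- by [].
- by move=> a; exists (domS a); [apply: pale_refl|rewrite /= mul_star].
(* In [a = p * b] and [b = q * a] the factors are the domains of [a] and [b], so they lie below each
   other and coincide; then [a = b * star b * b = b]. *)
- move=> a b [p pb ea] [q qa eb].
  have ep : domS a = p by rewrite ea domS_restr.
  have eq : domS b = q by rewrite eb domS_restr.
  rewrite ep in qa; rewrite eq in pb.
  by rewrite ea (pale_antisym pb qa) -eq /= mul_star.
- move=> a b c [p pb ->] [q qc eb].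
  rewrite eb domS_restr // in pb; rewrite eb mulgA (pale_mulr pb).
  by exists p => //; apply: pale_trans qc.
- move=> a b [p pb ->]; rewrite !obj_leE /= domS_restr //; split=> //.
  exact: codS_pale.
(* The factor moves across by conjugation: [star b * p = (star b * p * b) * star b]. *)
- move=> a b [p pb ->]; exists (codS (sval p * b)).
    have -> : domS (star b) = codS b by apply: PS_eq; rewrite /= starK.
    exact: codS_pale.
  by rewrite sval_codS_restr /= starM star_sval pale_dom_mul_r.
(* Composability forces [q = star b * p * b], the codomain of [p * b], so [a * c = p * b * star b *
   p * b * d = p * b * d]. *)
- move=> a b c d hac hbd [p pb ea] [q qd ec].
  have dbd : domS (b * d) = domS b.
    have /(congr1 sval) /= h := hbd.
    by apply: PS_eq; rewrite /= starM mulgA -(mulgA b) -h mulgA mul_star.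
  exists p; rewrite ?dbd //=.
  have eq : q = codS (sval p * b) by rewrite -ea [codS a]hac ec /= domS_restr.
  by rewrite ea ec eq sval_codS_restr !mulgA pale_dom_mul // sval_idem.
- move=> a p /obj_leE pa; exists (sval p * a); split.
    by split; [exists p|apply: domS_restr].
  by move=> u [[q qa ->]] /=; rewrite domS_restr // => ->.
Qed.

(** * Restriction maps and (G1) *)

Lemma restrE p a : pale p (domS a) -> restr (G := GS_gpd S) p a = sval p * a.
Proof.
move=> pa; rewrite /restr; case: pselect => [h|[]]; last first.
  by exists (sval p * a); split; [exists p|apply: domS_restr].
(* The chosen element is some [q * a] with domain [q], and its domain is [p]. *)
by case: (cid h) => u /= [[q qa ->]]; rewrite domS_restr // => ->.
Qed.

Lemma varthetaE a p : pale p (domS a) ->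
  sval (vartheta (X := GS_pgpd S) a p) = star a * sval p * a.
Proof. by move=> pa; rewrite /vartheta restrE // sval_codS_restr. Qed.

(** The factors [a * star a] coming from [theta (domS a) p] are absorbed by the outer [star a] and
    [a]. *)
Lemma ThetaE a p : sval (Theta (X := GS_pgpd S) a p) = star a * sval p * a.
Proof.
rewrite /Theta varthetaE; last exact: pale_theta.
by rewrite /= !mulgA star_mul_star mul_star_r.
Qed.

Lemma GS_is_pgpd : is_pgpd (GS_pgpd S).
Proof.
split=> [|a s t sa ta].
  split; [exact: PS_projalg|exact: GS_ordered_groupoid|exact: obj_leE].
apply: PS_eq; rewrite varthetaE; last exact: pale_trans (pale_theta _ _) ta.
rewrite !sval_theta !varthetaE // !mulgA.
(* The inner factors [a * star a] on the right-hand side are absorbed by [t] and [s], which lie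
   below [domS a]. *)
by rewrite !pale_dom_mul_r.
Qed.

(** * The evaluation map *)

Lemma foldl_mulprojS_hd p (s : seq (PS S)) :
  sval p * foldl (@mulprojS S) (sval p) s = foldl (@mulprojS S) (sval p) s.
Proof. by rewrite -foldl_mulprojS sval_idem. Qed.

(** Let [x] be the product from the second vertex [q] on, so [q * x = x]. Friendship gives
    [p * x * star x * p = p * q * p = p] and [star x * p * x = star x * q * p * q * x = star x *
    x]. *)
Lemma foldl_mulprojS_ends p (s : seq (PS S)) : path (@friendb (PS S)) p s ->
  domS (foldl (@mulprojS S) (sval p) s) = p /\
  codS (foldl (@mulprojS S) (sval p) s) = last p s.
Proof.
elim: s p => [|q s IHs] p /=; first by rewrite domS_sval codS_sval.
case/andP => /asboolP[pq qp] /IHs[]; rewrite [mulprojS (sval p) q]/mulprojS.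
rewrite foldl_mulprojS; set x := foldl _ _ _ => dx <-.
split; apply: PS_eq; rewrite /= starM star_sval.
  rewrite mulgA -(mulgA _ x) -[x * _]/(sval (domS x)) dx.
  by rewrite [in RHS]pq.
rewrite mulgA sval_idem_r.
have <- : sval q * x = x by rewrite /x foldl_mulprojS_hd.
have qpq : sval q * sval p * sval q = sval q by rewrite -sval_theta -[theta _ _]qp.
by rewrite starM star_sval !mulgA sval_idem_r -!(mulgA (star x)) qpq.
Qed.

Lemma domS_pprodS (s : ppath (PS S)) : domS (pprodS s) = phead s.
Proof. by case: s => p s hs; case: (foldl_mulprojS_ends hs). Qed.

Lemma codS_pprodS (s : ppath (PS S)) : codS (pprodS s) = plast s.
Proof. by case: s => p s hs; case: (foldl_mulprojS_ends hs). Qed.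

(** Since [r * (q * r * q) = r * q], each restricted vertex can be replaced by the original one. *)
Lemma foldl_mulprojS_restr p r (s : seq (PS S)) : pale r p ->
  foldl (@mulprojS S) (sval r) (scanl (fun x y : PS S => theta y x) r s) =
  sval r * foldl (@mulprojS S) (sval p) s.
Proof.
elim: s p r => [|q s IHs] p r rp /=; first by rewrite pale_mulr.
have foldM x t : foldl (@mulprojS S) (mulprojS x t) s =
    x * foldl (@mulprojS S) (sval t) s by apply: foldl_mulprojS.
rewrite foldM [mulprojS _ _]/mulprojS foldl_mulprojS (IHs q); last first.
  exact: pale_theta.
rewrite sval_theta !mulgA sval_alt (pale_mulr rp) -mulgA.
by rewrite foldl_mulprojS_hd.
Qed.

Lemma vmap_evS p : vmap (G := chain_gpd (PS S)) (G' := GS_gpd S) (@evS S) p = p.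
Proof. by rewrite /vmap /= evSE; apply: domS_pprodS. Qed.

Lemma evS_ordered_functor :
  is_ordered_functor (G := chain_gpd (PS S)) (G' := GS_gpd S) (@evS S).
Proof.
split.
- by move=> p; rewrite vmap_evS evSE.
- by move=> c; rewrite vmap_evS; apply: domS_pprodS.
- by move=> c; rewrite vmap_evS; apply: codS_pprodS.
- by move=> c d h h'; rewrite /= /chain_comp evSE pprodS_comp.
- move=> _ _ [s [t [-> -> [r rt [hs ts]]]]]; rewrite !evSE.
  exists r; first by rewrite domS_pprodS.
  by rewrite /pprodS hs ts; apply: foldl_mulprojS_restr.
Qed.

Lemma GS_weak_cpg : is_weak_cpg (GS S).
Proof.
split; [exact: GS_is_pgpd|exact: evS_ordered_functor|move=> p].
exact: evSE.
Qed.

(** * Linked pairs and (G2) *)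

Lemma evS_mkchain p (s : seq (PS S)) : path (@friendb (PS S)) p s ->
  evS (mkchain p s) = foldl (@mulprojS S) (sval p) s.
Proof. by move=> ps; rewrite /mkchain; case: pselect => // h; rewrite evSE. Qed.

Lemma gcompdE a b : codS a = domS b -> gcompd (G := GS_gpd S) a b = a * b.
Proof. by move=> h; rewrite /gcompd; case: pselect. Qed.

(** A common form for [lambda], with [p = e1] and [q = f1], and [rho], with [p = e2] and [q = f2].
    Friendship and the formula for [q] make the ends match, so each [gcompd] is a genuine
    product. *)
Lemma linked_composite e p b q f : friend e p -> friend q f ->
    pale p (domS b) -> sval q = star b * sval p * b ->
  gcompd (G := GS_gpd S)
    (gcompd (G := GS_gpd S) (evS (mkchain e [:: p])) (restr (G := GS_gpd S) p b))
    (evS (mkchain q [:: f])) = sval e * sval p * b * sval q * sval f.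
Proof.
move=> /ppair_subproof ep /ppair_subproof qf pb def_q.
have [_ /= c1] := foldl_mulprojS_ends ep.
have [/= d2 _] := foldl_mulprojS_ends qf.
have cd : codS (mulprojS (sval e) p) = domS (sval p * b).
  by rewrite c1 domS_restr.
have cq : codS (sval p * b) = q by apply: PS_eq; rewrite sval_codS_restr.
have cc : codS (mulprojS (sval e) p * (sval p * b)) = domS (mulprojS (sval q) f).
  rewrite d2 -[RHS]cq.
  exact: (gcod_comp GS_ordered_groupoid (a := mulprojS (sval e) p) cd).
rewrite !evS_mkchain // restrE //= (gcompdE cd).
by rewrite (gcompdE cc) /mulprojS !mulgA sval_idem_r.
Qed.

(* Since [sval e] factors as [e * q * y * q * e], the identity
   [e * q * e * q = e * q] gives [e * q * e = e]. *)
Lemma sandwich e q y :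
  sval e = sval e * sval q * y * sval q * sval e ->
  sval e * sval q * sval e = sval e.
Proof.
move=> ey; rewrite [X in _ * _ * X]ey !mulgA.
by rewrite sval_alt -ey.
Qed.

Lemma GS_G2 b e f : linked (X := GS_pgpd S) b e f ->
  lambda (X := GS S) e b f = rho (X := GS S) e b f.
Proof.
case=> hf he; have := congr1 sval he; have := congr1 sval hf.
rewrite !sval_theta !ThetaE starK !mulgA => sf se.
(* Padding [b] and [star b] with [b * star b] in [e = e * b * f * star b * e] exhibits [domS b] next
   to both outer factors, as [sandwich] requires. *)
have eqe : sval e * b * star b * sval e = sval e.
  have := @sandwich e (domS b) (b * sval f * star b).
  by rewrite /= !mulgA mul_star_r star_mul_star_r => ->.
have frf : sval f * star b * b * sval f = sval f.
  have := @sandwich f (codS b) (star b * sval e * b).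
  by rewrite /= !mulgA star_mul_star_r mul_star_r => ->.
have eqe_r x : x * sval e * b * star b * sval e = x * sval e.
  by rewrite -[in RHS]eqe !mulgA.
have frf_r x : x * sval f * star b * b * sval f = x * sval f.
  by rewrite -[in RHS]frf !mulgA.
have se_r x : x * sval e * b * sval f * star b * sval e = x * sval e.
  by rewrite [in RHS]se !mulgA.
have sf_r x : x * sval f * star b * sval e * b * sval f = x * sval f.
  by rewrite [in RHS]sf !mulgA.
have fe1 : friend e (theta (domS b) e).
  by split; apply: PS_eq; rewrite /= !mulgA ?eqe ?eqe_r.
have ff2 : friend (theta (codS b) f) f.
  by split; apply: PS_eq; rewrite /= !mulgA ?frf ?frf_r.
have fe2 : friend e (Theta (X := GS_pgpd S) (star b) f).
  by split=> //; apply: PS_eq; rewrite sval_theta !ThetaE starK !mulgA sf_r.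
have ff1 : friend (Theta (X := GS_pgpd S) b e) f.
  by split=> //; apply: PS_eq; rewrite sval_theta !ThetaE !mulgA se_r.
have e2b : pale (Theta (X := GS_pgpd S) (star b) f) (domS b).
  by apply: mul_pale; rewrite ThetaE starK /= !mulgA ?mul_star ?star_mul_star_r.
(* Both sides are equal to [e * b * f]. *)
rewrite /lambda /rho /= !linked_composite //.
- rewrite !ThetaE starK /= !mulgA.
  by rewrite !mul_star_r !eqe !frf_r.
- by rewrite !ThetaE starK /= !mulgA.
- exact: pale_theta.
- by rewrite !ThetaE /= !mulgA star_mul_star mul_star_r.
Qed.

Lemma GS_is_cpg : is_cpg (GS S).
Proof. by split; [exact: GS_weak_cpg|exact: GS_G2]. Qed.

End RegularStar.

(** * Homomorphisms as chained projection functors *)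

Section StarHom.
Variables (S T : rssType) (phi : star_hom S T).

(** The image of a projection is a projection, hence its own domain. *)
Lemma vmap_star_hom (p : PS S) :
  sval (vmap (G := GS_gpd S) (G' := GS_gpd T) phi p) = phi (sval p).
Proof.
by rewrite /vmap /= -(star_homS (star_homP phi)) -(star_homM (star_homP phi))
  star_sval sval_idem.
Qed.

Lemma star_hom_pgpd_morphism :
  is_pgpd_morphism (X := GS_pgpd S) (Y := GS_pgpd T) phi.
Proof.
have HM := star_homM (star_homP phi); have HS := star_homS (star_homP phi).
have Hth : is_projalg_morphism (vmap (G := GS_gpd S) (G' := GS_gpd T) phi).
  by move=> p q; apply: PS_eq; rewrite !(sval_theta, vmap_star_hom) !HM.
have Hd a : domS (phi a) = vmap (G := GS_gpd S) (G' := GS_gpd T) phi (domS a).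
  by apply: PS_eq; rewrite vmap_star_hom /= HM HS.
split=> //; split=> //.
- by move=> p; apply: esym; apply: vmap_star_hom.
- by move=> a; apply: PS_eq; rewrite vmap_star_hom /= HM HS.
- by move=> a b h h' /=; rewrite HM.
- move=> a b [p pb ->].
  exists (vmap (G := GS_gpd S) (G' := GS_gpd T) phi p); last first.
    by rewrite vmap_star_hom HM.
  by rewrite Hd /pale -Hth -[theta _ p]pb.
Qed.

Lemma star_hom_chained_functor :
  is_chained_functor (X := GS S) (Y := GS T) phi.
Proof.
have [_ Hth] := star_hom_pgpd_morphism.
split=> [|p s ps]; first exact: star_hom_pgpd_morphism.
rewrite /= !evS_mkchain //; last exact: (friend_morphism Hth ps).
rewrite vmap_star_hom.
(* The initial factor is generalized to an arbitrary [x], since it changes along the fold. *)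
elim: s (sval p) {ps} => [//|q s IHs] x /=; rewrite IHs.
by rewrite /mulprojS (star_homM (star_homP phi)) vmap_star_hom.
Qed.

End StarHom.

Theorem theorem6p42 :
  exists (G_ob : forall S : rssType, is_cpg (GS S))
         (G_hom : forall (S T : rssType) (phi : star_hom S T),
            @is_chained_functor (GS S) (GS T) phi),
    @is_functor RSS CPG
      (fun S : rssType => CPGOb (G_ob S))
      (fun (S T : rssType) (phi : star_hom S T) =>
         @ChainedFunctor (GS S) (GS T) phi (G_hom S T phi)).
Proof.
exists GS_is_cpg, star_hom_chained_functor.
(* A chained functor is determined by its underlying map, and the two sides of each law have the
   same underlying map by computation. *)
by split=> [S|S T U f g]; apply: chained_functor_eq.
Qed.
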